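(* Let $q$ be an odd prime power with $q\equiv 1\pmod 4$. Then (i) the Paley graph $P(q)$ belongs to $\mathfrak{Gr}(q,(q+3)/2)$; (ii) for every $i=0,1,\dots,q+1$ there exists a graph in $\mathfrak{Gr}(q+i,(q+3)/2+i)$.
   Context: All graphs are finite, simple and undirected. For a prime power $q\equiv1\pmod 4$, the Paley graph $P(q)$ has as vertex set the finite field $F_q$, with distinct $i,j$ adjacent if and only if $i-j$ is a nonzero square in $F_q$. For a graph $G=(V,E)$ and $x\in V$, $N[x]=\{x\}\cup\{y: xy\in E\}$. A set $C\subseteq V$ is identifying if $N[x]\cap C\ne\emptyset$ for every $x\in V$ and $N[x]\cap C\neq N[y]\cap C$ for all distinct $x,y\in V$. For $n\ge k\ge1$, $\mathfrak{Gr}(n,k)$ is the set of graphs on $n$ vertices in which every $k$-element subset of vertices is identifying. *)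

(* Defs.v *)
From HB Require Import structures.
From mathcomp Require Import all_boot all_order all_fingroup all_algebra all_solvable all_field.
Set Implicit Arguments. Unset Strict Implicit. Unset Printing Implicit Defensive.
Import GRing.Theory.

Record sgraph := SGraph {
  vertex :> finType;
  adj : rel vertex;
  adj_sym : symmetric adj;
  adj_irrefl : irreflexive adj }.

Definition clneigh (G : sgraph) (x : G) : {set G} := x |: [set y | adj x y].

Definition identifying (G : sgraph) (C : {set G}) : Prop :=
  (forall x : G, clneigh x :&: C != set0) /\
  (forall x y : G, x != y -> clneigh x :&: C != clneigh y :&: C).

(* The range [1 <= k <= n] is part of the predicate, so that membership is
   never vacuous for lack of [k]-subsets. *)
Definition Gr (n k : nat) (G : sgraph) : Prop :=
  [/\ 1 <= k <= n, #|G| = n &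
      forall C : {set G}, #|C| = k -> identifying C].

Section Paley.
Local Open Scope ring_scope.
Variable F : finFieldType.

Definition nonzero_square (a : F) : bool := (a != 0) && [exists z, a == z ^+ 2].

Definition paley_adj : rel F := fun i j => (i != j) && nonzero_square (i - j).

Lemma sqrt_opp1 : #|F| = 1 %[mod 4] -> exists z : F, z ^+ 2 = -1.
Proof.
move=> F4.
have cardU : #|[set: {unit F}]| = #|F|.-1 by rewrite card_finField_unit.
have [g Ug] := cyclicP (field_unit_group_cyclic [set: {unit F}]%G).
have og : #[g]%g = #|F|.-1 by rewrite -cardU Ug.
have F1 : (1 < #|F|)%N by apply: finNzRing_gt1.
have [m Fm] : exists m, #|F| = (4 * m).+1.
  by exists (#|F| %/ 4)%N; rewrite {1}(divn_eq #|F| 4) F4 addn1 mulnC.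
have m0 : (0 < m)%N by move: F1; rewrite Fm; case: (m).
move: og; rewrite Fm /= => og.
exists (FinRing.uval (g ^+ m)%g).
set h := FinRing.uval _.
have h4 : h ^+ 4 = 1.
  rewrite /h -FinRing.val_unitX -expgM mulnC -og expg_order //.
have h2 : h ^+ 2 != 1.
  rewrite /h -FinRing.val_unitX -expgM; apply/negP => /eqP e.
  have /eqP : (g ^+ (m * 2) = 1)%g by apply: val_inj.
  rewrite -order_dvdn og => /dvdn_leq.
  by rewrite muln_gt0 m0 mulnC leq_pmul2l // => /(_ isT).
have /eqP : (h ^+ 2) ^+ 2 = 1 by rewrite -exprM.
by rewrite sqrf_eq1 (negbTE h2) /= => /eqP.
Qed.

Lemma paley_irrefl : irreflexive paley_adj.
Proof. by move=> x; rewrite /paley_adj eqxx. Qed.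

Lemma paley_sym : #|F| = 1 %[mod 4] -> symmetric paley_adj.
Proof.
move=> /sqrt_opp1 [w w2] x y; rewrite /paley_adj eq_sym; congr (_ && _).
have sub (a : F) : nonzero_square a -> nonzero_square (- a).
  case/andP=> a0 /existsP[z /eqP az]; rewrite /nonzero_square oppr_eq0 a0.
  by apply/existsP; exists (w * z); rewrite exprMn w2 mulN1r az.
by apply/idP/idP => /sub; rewrite opprB.
Qed.

Definition paley (q : nat) (cardF : #|F| = q) (q4 : q = 1 %[mod 4]) : sgraph :=
  SGraph (paley_sym (etrans (congr1 (modn^~ 4) cardF) q4)) paley_irrefl.
End Paley.

(* Main.v *)
(* Every k-subset of an n-vertex graph is identifying as soon as all closed
   neighbourhoods, and all symmetric differences of two of them, have more than
   n - k elements; here n - k + 1 = (q-1)/2. Let chi be the quadratic character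
   of F_q. The sets N[x], their "dual" versions F_q \ N(x), and F_q itself have
   sign vectors y |-> chi(x-y) + [x=y], y |-> -chi(x-y) + [x=y] and y |-> 1, and
   the Jacobsthal sum sum_y chi(x-y) chi(z-y) = -1 (x <> z) shows that any two of
   these 2q+1 vectors have inner product at most 1, i.e. the sets differ in at
   least (q-1)/2 places. For (ii), add to P(q) a set of i <= q+1 independent
   vertices, joined to P(q) along distinct sets among F_q and the F_q \ N(x):
   the traces on F_q of the closed neighbourhoods already differ enough. *)
Require Import Defs.
From mathcomp Require Import all_boot all_order all_fingroup all_algebra all_solvable all_field.
From mathcomp Require Import zify ring.
Set Implicit Arguments. Unset Strict Implicit. Unset Printing Implicit Defensive.
Import Order.TTheory GRing.Theory Num.Theory.

(** * Counting criterion for identifying sets *)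

Definition symdiff (T : finType) (A B : {set T}) : {set T} :=
  (A :\: B) :|: (B :\: A).

Lemma in_symdiff (T : finType) (A B : {set T}) x :
  (x \in symdiff A B) = ((x \in A) != (x \in B)).
Proof. by rewrite !inE; case: (x \in A); case: (x \in B). Qed.

Lemma setI_neq0_card (T : finType) (A C : {set T}) :
  #|T| < #|C| + #|A| -> A :&: C != set0.
Proof.
move=> h; apply/eqP => AC0; move: h.
by rewrite addnC -cardsUI AC0 cards0 addn0 ltnNge max_card.
Qed.

Lemma Gr_symdiff (n k : nat) (G : sgraph) :
  1 <= k <= n -> #|G| = n ->
  (forall x : G, n < k + #|clneigh x|) ->
  (forall x y : G, x != y -> n < k + #|symdiff (clneigh x) (clneigh y)|) ->
  Gr n k G.
Proof.
move=> kn Gn hN hD; split=> // C Ck; split=> [x|x y xy].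
  by apply: setI_neq0_card; rewrite Gn Ck.
have /set0Pn[z] : symdiff (clneigh x) (clneigh y) :&: C != set0.
  by apply: setI_neq0_card; rewrite Gn Ck; apply: hD.
rewrite inE in_symdiff => /andP[dz Cz]; apply: contraNneq dz => /setP/(_ z).
by rewrite ![z \in _ :&: C]inE Cz !andbT => ->.
Qed.

(** * Sign vectors and their inner products *)

Section Signs.
Local Open Scope ring_scope.
Variable T : finType.

Definition setsign (A : {set T}) (y : T) : int := (-1) ^+ (y \notin A).

(** Places of agreement contribute [1], places of disagreement [-1]. *)
Lemma sum_setsign (A B : {set T}) :
  \sum_y setsign A y * setsign B y = #|T|%:Z - (#|symdiff A B|.*2)%:Z.
Proof.
rewrite -muln2 PoszM -!natz mulr_natr -!sum1_card !natr_sum [X in _ - X *+ 2]big_mkcond /= -sumrMnl -sumrB.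
apply: eq_bigr => y _; rewrite in_symdiff /setsign.
by case: (y \in A); case: (y \in B).
Qed.
End Signs.

Lemma sum_mulr_delta (R : pzSemiRingType) (T : finType) (a : T -> R) x :
  (\sum_y a y * (x == y)%:R = a x)%R.
Proof.
rewrite (bigD1 x) //= eqxx mulr1 big1 ?addr0 // => y.
by rewrite eq_sym => /negbTE->; rewrite mulr0.
Qed.

(** * The quadratic character and its sums *)

Section QuadraticCharacter.
Local Open Scope ring_scope.
Variable F : finFieldType.
Hypothesis oddF : odd #|F|.

Definition chi (a : F) : int :=
  if a == 0 then 0 else (-1) ^+ ~~ nonzero_square a.

Lemma chi0 : chi 0 = 0.
Proof. by rewrite /chi eqxx. Qed.

(** The nonzero elements are [#|F| - 1] distinct roots of [X ^ (#|F| - 1) - 1], so one of them is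
    primitive. *)
Lemma finField_prim_root :
  exists g : F, #|F|.-1.-primitive_root g.
Proof.
have F1 : (1 < #|F|)%N := finNzRing_gt1 F.
pose rs := enum [pred x : F | x != 0].
have : has #|F|.-1.-primitive_root rs.
  apply: has_prim_root; rewrite ?enum_uniq //; first by case: #|F| F1 => [|[]].
    apply/allP => x; rewrite mem_enum inE => x0; rewrite unity_rootE.
    apply/eqP/(mulfI x0); rewrite -exprS prednK ?expf_card ?mulr1 //.
    exact: ltnW.
  rewrite -cardE -(cardC1 (0 : F)); apply: eq_leq; exact: eq_card.
by case/hasP => g _ gP; exists g.
Qed.

Lemma primitive_power (g : F) : #|F|.-1.-primitive_root g ->
  forall a, a != 0 -> exists n, a = g ^+ n.
Proof.
move=> gP a a0; case: (prim_rootP gP (x := a)) => [|i ->]; last by exists i.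
apply/(mulfI a0); rewrite -exprS prednK ?expf_card ?mulr1 //.
exact: ltnW (finNzRing_gt1 F).
Qed.

Lemma chi_primitive_power (g : F) n : #|F|.-1.-primitive_root g ->
  chi (g ^+ n) = (-1) ^+ n.
Proof.
move=> gP; have g0 : g != 0.
  apply/eqP => g0; have /eqP := prim_expr_order gP.
  by rewrite g0 expr0n gtn_eqF ?(prim_order_gt0 gP) // eq_sym oner_eq0.
have sqE : [exists z, g ^+ n == z ^+ 2] = ~~ odd n.
  apply/existsP/idP => [[z /eqP gz]|n2]; last first.
    by exists (g ^+ n./2); rewrite -exprM muln2 even_halfK.
  have z0 : z != 0 by rewrite -sqrf_eq0 -gz expf_neq0.
  have [m zm] := primitive_power gP z0.
  move: gz => /eqP; rewrite zm -exprM (eq_prim_root_expr gP) => /eqP nm.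
  (* Exponents of [g] are determined modulo [#|F| - 1] only; as this is even, their parity is well
     defined. *)
  have q2 : (2 %| #|F|.-1)%N.
    by rewrite dvdn2 -subn1 oddB ?oddF //; apply: ltnW (finNzRing_gt1 F).
  by rewrite -dvdn2 /dvdn -(modn_dvdm n q2) nm modn_dvdm // modnMl.
by rewrite /chi /nonzero_square expf_neq0 //= expf_eq0 (negbTE g0) andbF sqE
  negbK signr_odd.
Qed.

Lemma chiM a b : chi (a * b) = chi a * chi b.
Proof.
have [->|a0] := eqVneq a 0; first by rewrite mul0r chi0 mul0r.
have [->|b0] := eqVneq b 0; first by rewrite mulr0 chi0 mulr0.
have [g gP] := finField_prim_root.
have [n ->] := primitive_power gP a0; have [m ->] := primitive_power gP b0.
by rewrite -exprD !(chi_primitive_power _ gP) exprD.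
Qed.

Lemma chi_sqr a : a != 0 -> chi (a ^+ 2) = 1.
Proof.
move=> a0; rewrite /chi /nonzero_square sqrf_eq0 (negbTE a0) /=.
by have -> : [exists z, a ^+ 2 == z ^+ 2] by apply/existsP; exists a.
Qed.

Lemma chi1 : chi 1 = 1.
Proof. by rewrite -[1 in LHS](expr1n _ 2) chi_sqr ?oner_neq0. Qed.

Lemma chi_le1 a : chi a <= 1.
Proof. by rewrite /chi; case: (a == 0) => //; case: nonzero_square. Qed.

(** Multiplication by a primitive root permutes the field and flips the sign of [chi]. *)
Lemma sum_chi : \sum_a chi a = 0.
Proof.
have [g gP] := finField_prim_root.
have chig : chi g = -1 by rewrite -[g]expr1 chi_primitive_power.
have g0 : g != 0 by apply: contra_eq_neq chig => ->; rewrite chi0.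
have : \sum_a chi a = - \sum_a chi a.
  rewrite {1}(reindex_inj (mulfI g0)) -sumrN; apply: eq_bigr => a _.
  by rewrite chiM chig mulN1r.
by lia.
Qed.

Lemma sum_chi_sub x : \sum_y chi (x - y) = 0.
Proof.
rewrite -[RHS]sum_chi [RHS](reindex_inj (inv_inj (subKr x))).
exact: eq_bigr.
Qed.

(* For [t != 0], [t * (c + t) = t ^+ 2 * (c / t + 1)]; as [0^-1 = 0], the map
   [t |-> c / t + 1] is a permutation of [F] sending [0] to [1]. *)
Lemma jacobsthal_sum (x z : F) : x != z ->
  \sum_y chi (x - y) * chi (z - y) = -1.
Proof.
move=> xz; have c0 : z - x != 0 by rewrite subr_eq0 eq_sym.
rewrite (reindex_inj (inv_inj (subKr x))) /=; set c := z - x in c0 *.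
have -> : \sum_y chi (x - (x - y)) * chi (z - (x - y)) =
          \sum_t (chi (c / t + 1) - (t == 0)%:R).
  apply: eq_bigr => t _; rewrite subKr opprB addrCA addrC -/c.
  have [->|t0] := eqVneq t 0.
    by rewrite chi0 mul0r invr0 mulr0 add0r chi1 subrr.
  rewrite subr0 -chiM -[RHS]mul1r -(chi_sqr t0) -chiM; congr chi.
  by field.
rewrite sumrB; have -> : \sum_t chi (c / t + 1) = 0.
  rewrite -[RHS]sum_chi [RHS](reindex_inj (h := fun t => c / t + 1)) //.
  by move=> s t /addIr/(mulfI c0)/invr_inj.
rewrite (bigD1 0) //= eqxx big1 ?addr0 ?sub0r // => t /negbTE -> //.
Qed.
End QuadraticCharacter.

(** * Codewords and their pairwise distances *)

Section Codewords.
Variable F : finFieldType.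

(* [Some (true, x)] is the closed neighbourhood of [x] in the Paley graph,
   [Some (false, x)] the complement of its open neighbourhood. *)
Definition codeword (c : option (bool * F)) : {set F} :=
  if c is Some (b, x) then
    [set y | (x == y) || (nonzero_square (x - y)%R == b)]
  else setT.

Arguments codeword : simpl never.

Local Open Scope ring_scope.

Lemma setsign_codeword b x y :
  setsign (codeword (Some (b, x))) y =
  (-1) ^+ (~~ b) * chi (x - y) + (x == y)%:R.
Proof.
rewrite /setsign inE /chi subr_eq0; case: eqVneq => [->|_] /=.
  by rewrite mulr0 add0r.
by case: b; case: nonzero_square.
Qed.

Lemma sum_setsign_codeword b x :
  odd #|F| -> \sum_y setsign (codeword (Some (b, x))) y = 1.
Proof.
move=> oddF; under eq_bigr do rewrite setsign_codeword.
rewrite big_split /= -mulr_sumr sum_chi_sub // mulr0 add0r.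
under eq_bigr do rewrite -[_%:R]mul1r.
by rewrite sum_mulr_delta.
Qed.

Lemma setsign_setT y : setsign (codeword None) y = 1.
Proof. by rewrite /setsign inE. Qed.

Hypothesis F4 : #|F| = 1 %[mod 4].

Let oddF : odd #|F|.
Proof. by move: F4; lia. Qed.

Lemma chi_subC (x y : F) : chi (x - y) = chi (y - x).
Proof.
rewrite /chi !subr_eq0 eq_sym; case: eqVneq => // yx.
by have := paley_sym F4 x y; rewrite /paley_adj eq_sym yx /= => ->.
Qed.

(** With signs [s], [t] for the tags [b], [d], the sum expands to [s * t * J + (s + t) * chi (x - z)
    + [x = z]], where [J] sums [chi (x - y) * chi (z - y)]. For [x != z], [J = -1] and the bound
    follows by cases on the signs. *)
Lemma sum_setsign_codewords c d : c != d ->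
  \sum_y setsign (codeword c) y * setsign (codeword d) y <= 1.
Proof.
case: c d => [[b x]|] [[d z]|] // neq; first last.
- under eq_bigr do rewrite setsign_setT mul1r.
  by rewrite sum_setsign_codeword.
- under eq_bigr do rewrite setsign_setT mulr1.
  by rewrite sum_setsign_codeword.
under eq_bigr => y _ do rewrite [setsign (codeword (Some (d, z))) y]
  setsign_codeword mulrDr mulrCA.
rewrite big_split -mulr_sumr /= sum_mulr_delta setsign_codeword.
under eq_bigr => y _ do rewrite setsign_codeword mulrDl -mulrA.
rewrite big_split -mulr_sumr /=.
under [X in _ * (_ + X)]eq_bigr => y _ do rewrite mulrC.
rewrite sum_mulr_delta [chi (z - x)]chi_subC.
(* If [x = z], the signs are opposite and the sum is [1 - S] with [S] a sum of squares. *)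
have [xz|xz] := eqVneq x z.
  rewrite xz subrr chi0.
  have : \sum_y chi (z - y) * chi (z - y) >= 0.
    by apply: sumr_ge0 => y _; rewrite -expr2 sqr_ge0.
  move: (\sum_y _) => S; move: neq; rewrite xz.
  by case: b; case: d => /=; rewrite ?eqxx //; lia.
rewrite jacobsthal_sum //; have := chi_le1 (x - z).
have : -1 <= chi (x - z).
  by rewrite /chi; case: (_ == 0) => //; case: nonzero_square.
by case: b neq; case: d => /=; lia.
Qed.

Lemma card_symdiff_codewords c d : c != d ->
  (#|F| <= (#|symdiff (codeword c) (codeword d)|).*2.+1)%N.
Proof.
move=> /sum_setsign_codewords; rewrite sum_setsign.
move: #|symdiff _ _| #|F| => m n; lia.
Qed.

Lemma card_codeword c : (#|F| <= (#|codeword c|).*2.+1)%N.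
Proof.
case: c => [[b x]|]; last first.
  by rewrite cardsT ltnW // ltnS -addnn leq_addr.
(* The sign vector of [set0] is constantly [-1]. *)
have := sum_setsign (codeword (Some (b, x))) set0.
have -> : symdiff (codeword (Some (b, x))) set0 = codeword (Some (b, x)).
  by apply/setP => y; rewrite in_symdiff in_set0; case: (y \in _).
under eq_bigr => y _ do rewrite {2}/setsign in_set0 mulrN1.
rewrite sumrN sum_setsign_codeword //.
by move: #|codeword _| #|F| => m n; lia.
Qed.
End Codewords.

(** * From codewords to graphs *)

(** This serves both claims: [f] places the field among the vertices, and [h] labels each vertex by
    its trace there. Bounds on traces suffice, as preimages under an injection cannot be larger. *)
Lemma Gr_codewords (F : finFieldType) (G : sgraph) (i : nat)
    (f : F -> G) (h : G -> option (bool * F)) :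
  #|F| = 1 %[mod 4] -> #|G| = #|F| + i -> injective f -> injective h ->
  (forall u, f @^-1: clneigh u = codeword (h u)) ->
  Gr (#|F| + i) ((#|F| + 3) %/ 2 + i) G.
Proof.
move=> F4 cardG f_inj h_inj fh; have F1 := finNzRing_gt1 F.
have card_preim (A : {set G}) : #|f @^-1: A| <= #|A|.
  rewrite -(card_imset _ f_inj); apply/subset_leq_card/subsetP => u.
  by case/imsetP=> y; rewrite inE => Afy ->.
apply: Gr_symdiff => // [|u|u v uv].
  by clear cardG; move: #|F| F4 F1 => *; lia.
  have := card_codeword F4 (h u); have := card_preim (clneigh u).
  by rewrite fh; move: #|F| #|codeword _| #|clneigh _| F4 F1 => *; lia.
have := card_preim (symdiff (clneigh u) (clneigh v)).
have -> : f @^-1: symdiff (clneigh u) (clneigh v) =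
          symdiff (codeword (h u)) (codeword (h v)).
  by apply/setP => y; rewrite -!fh inE !in_symdiff !inE.
have /(card_symdiff_codewords F4) : h u != h v by rewrite (inj_eq h_inj).
(* The count is tight: [(#|F| + 3) / 2 + i + (#|F| - 1) / 2 = #|F| + i + 1]. *)
move: #|F| #|symdiff (codeword _) _| #|symdiff (clneigh _) _| F4 F1 => *.
by lia.
Qed.

(** * Adding independent vertices to the Paley graph *)

Section Extension.
Variables (F : finFieldType) (i : nat) (h : 'I_i -> option (bool * F)).
Hypothesis F4 : #|F| = 1 %[mod 4].

Definition ext_adj (u v : F + 'I_i) : bool :=
  match u, v with
  | inl x, inl y => paley_adj x y
  | inl x, inr k | inr k, inl x => x \in codeword (h k)
  | inr _, inr _ => false
  end.

Lemma ext_sym : symmetric ext_adj.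
Proof. by case=> [x|k] [y|l] //=; apply: paley_sym. Qed.

Lemma ext_irrefl : irreflexive ext_adj.
Proof. by case=> [x|k] //=; apply: paley_irrefl. Qed.

Definition ext_graph := SGraph ext_sym ext_irrefl.
End Extension.

Lemma codeword_paley (F : finFieldType) (x y : F) :
  (y \in codeword (Some (true, x))) = (y == x) || paley_adj x y.
Proof.
by rewrite inE /paley_adj [y == x]eq_sym; case: eqVneq => //=.
Qed.

Lemma exists_Gr_ext (F : finFieldType) (i : nat) :
  #|F| = 1 %[mod 4] -> i <= #|F| + 1 ->
  exists G : sgraph, Gr (#|F| + i) ((#|F| + 3) %/ 2 + i) G.
Proof.
move=> F4 iF.
have iF' : i <= #|{: option F}| by rewrite card_option -addn1.
(* The labels left for new vertices are [None] and the [Some (false, x)], as Paley vertices take the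
   tag [true]; there are [#|F| + 1] of them, whence the bound on [i]. *)
pose h (k : 'I_i) := omap (pair false) (enum_val (widen_ord iF' k)).
have h_inj : injective h.
  have pair_inj : injective (omap (pair false) : option F -> _).
    by move=> [x|] [y|] //= [->].
  by move=> k l /pair_inj/enum_val_inj/(congr1 val) kl; apply: val_inj.
exists (ext_graph h F4).
apply: (@Gr_codewords F (ext_graph h F4) i (@inl F 'I_i)
  (fun u => match u with inl x => Some (true, x) | inr k => h k end)) => //.
- by rewrite card_sum card_ord.
- by move=> x y [].
- case=> [x|k] [y|l] //; first by case=> ->.
  + by rewrite /h; case: enum_val.
  + by rewrite /h; case: enum_val.
  + by move/h_inj ->.
- case=> [x|k]; apply/setP => y.
  + by rewrite codeword_paley !inE.
  + by rewrite !inE.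
Qed.

Theorem theorem27 (q : nat)
    (q_ppow : exists p k : nat, [/\ prime p, 0 < k & q = p ^ k])
    (q_odd : odd q) (q4 : q = 1 %[mod 4]) :
  (forall (F : finFieldType) (cardF : #|F| = q),
      Gr q ((q + 3) %/ 2) (paley cardF q4)) /\
  (forall i : nat, i <= q + 1 ->
      exists G : sgraph, Gr (q + i) ((q + 3) %/ 2 + i) G).
Proof.
split=> [F cardF|i iq].
  have F4 : #|F| = 1 %[mod 4] by rewrite cardF.
  rewrite -[in Gr _]cardF -[#|F|]addn0 -[X in Gr _ X]addn0 -[X in (X + 3) %/ 2]cardF.
  apply: (@Gr_codewords F (paley cardF q4) 0 id (fun x => Some (true, x))) => //.
  - by rewrite addn0.
  - by move=> x y [].
  - by move=> x; apply/setP => y; rewrite codeword_paley !inE.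
have [p [k [p_pr k0 qpk]]] := q_ppow.
have [F _ cardF] := PrimePowerField p_pr k0.
rewrite -qpk in cardF; move: q4 iq; rewrite -cardF; exact: exists_Gr_ext.
Qed.
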